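(* Let $F\subseteq\mathbb{R}^n$, $f\colon\mathbb{R}^n\to\mathbb{R}$, let $(\mathcal{C},\mathcal{D},g,z,\mathcal{T},\epsilon)$ be an $(F,f)$-valid configuration and let $C\in\mathcal{D}$. Then $(\mathcal{C}\cup\{C\},\mathcal{D}\setminus\{C\},g,z,\mathcal{T},\epsilon)$ is also $(F,f)$-valid.
   Context: Constraints are arbitrary subsets of $\mathbb{R}^n$. For $\mathcal{C}\subseteq\mathcal{P}(\mathbb{R}^n)$ (power set) write $\bigcap\mathcal{C}=\bigcap_{C\in\mathcal{C}}C$, with $\bigcap\emptyset=\mathbb{R}^n$. For a list $\tau=(i_1,\dots,i_k)\in\{\pm1,\dots,\pm n\}^k$ write $\tau(x)=(\mathrm{sgn}(i_1)x_{|i_1|},\dots,\mathrm{sgn}(i_k)x_{|i_k|})\in\mathbb{R}^k$ for $x\in\mathbb{R}^n$ and $\tau(C)=\{\tau(x):x\in C\}$ for $C\subseteq\mathbb{R}^n$; the empty list is allowed. For another list $\tau'=(i'_1,\dots,i'_{k'})$, write $\tau\trianglelefteq\tau'$ if $k\le k'$ and $i_j=i'_j$ for all $1\le j\le k$. For a node $v$ of a directed graph, $\delta^+(v)$ is its set of children. Branching tree: a tuple $\mathcal{T}=(V,E,B,\sigma)$ is a $\mathcal{C}$-consistent branching tree if: (T1) $(V,E)$ is an arborescence with $1\le|V|<\infty$ and root $r\in V$. (T2) Each $v\in V$ has a branching constraint $B_v\subseteq\mathbb{R}^n$, and $B_r=\mathbb{R}^n$. (T3) For all $u\in V$ with $\delta^+(u)\ne\emptyset$: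 $\bigcap\mathcal{C}\subseteq\bigcup_{v\in\delta^+(u)}B_v$. (T4) Each $v\in V$ has a list $\sigma_v\in\{\pm1,\dots,\pm n\}^{\ell_v}$, $\ell_v\in\{0,\dots,n\}$, with $|(\sigma_v)_1|,\dots,|(\sigma_v)_{\ell_v}|$ pairwise distinct. (T5) $\sigma_u\trianglelefteq\sigma_v$ for all $u\in V$, $v\in\delta^+(u)$. (T6) For all $v\in V$ and $1\le i\le\ell_v$: $\max\{\sigma_v(x)_i:x\in\bigcap\mathcal{C}\}<\infty$ (i.e. the set is bounded above). (T7) For all $u\in V$ and $v\ne w$ in $\delta^+(u)$: $\sigma_u(B_v)\cap\sigma_u(B_w)=\emptyset$. Relations: for $v\in V$ let $\mathcal{B}_v=\{B_u: u \text{ is a node on the } r\text{-}v\text{-path in } \mathcal{T}\}$. For $x,y\in\bigcap\mathcal{C}$ let $\mathrm{dcn}(x,y)$ be the deepest node $w\in V$ with $x,y\in\bigcap(\mathcal{C}\cup\mathcal{B}_w)$. For $\epsilon>0$ and $a,b\in\mathbb{R}^k$, let $a\succ_\epsilon b$ mean $a\neq b$ and $a_i\ge b_i+\epsilon$ for the smallest index $i$ with $a_i\ne b_i$. For $x,y\in\bigcap\mathcal{C}$ and $v=\mathrm{dcn}(x,y)$: $x\succeq_{\epsilon,\mathcal{T}}y$ iff $\sigma_v(x)=\sigma_v(y)$ or $\sigma_v(x)\succ_\epsilon\sigma_v(y)$; $x\succ_{\epsilon,\mathcal{T}}y$ iff $\sigma_v(x)\succ_\epsilon\sigma_v(y)$.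 Configuration: let $F\subseteq\mathbb{R}^n$, $f\colon\mathbb{R}^n\to\mathbb{R}$. A configuration $(\mathcal{C},\mathcal{D},g,z,\mathcal{T},\epsilon)$ with $\mathcal{C},\mathcal{D}\subseteq\mathcal{P}(\mathbb{R}^n)$, $g\colon\mathbb{R}^n\to\mathbb{R}$, $z\in\mathbb{R}\cup\{\infty\}$, $\mathcal{T}$ a branching tree and $\epsilon$ a real number is $(F,f)$-valid if: (V1) $\mathcal{T}$ is $\mathcal{C}$-consistent and $\epsilon>0$. (V2) If $z<\infty$, there exists $x\in F$ with $f(x)\le z$. (V3) For all real $\hat z<z$, there exists $x\in F$ with $f(x)\le\hat z$ if and only if there exists $x\in\bigcap\mathcal{C}$ with $g(x)\le\hat z$. (V4) For every $x\in\bigcap\mathcal{C}$ with $g(x)<z$ there exists $y\in\bigcap(\mathcal{C}\cup\mathcal{D})$ with $y\succeq_{\epsilon,\mathcal{T}}x$ and $g(y)\le g(x)$. *)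

(* Defs.v *)
From HB Require Import structures.
From mathcomp Require Import all_boot all_order all_algebra.
From mathcomp Require Import all_classical all_reals.

Set Implicit Arguments.
Unset Strict Implicit.
Unset Printing Implicit Defensive.

Import Order.TTheory GRing.Theory Num.Theory.

Local Open Scope classical_set_scope.
Local Open Scope ring_scope.

(* (i, b) : sidx n stands for the signed index +(i+1) if b = false and        *)
(* -(i+1) if b = true, so that sidx n is the set {±1, ..., ±n}.               *)
Definition sidx (n : nat) : Type := ('I_n * bool)%type.

Definition sproj (R : realType) (n : nat) (tau : seq (sidx n))
    (x : 'rV[R]_n) : 'rV[R]_(size tau) :=
  \row_(j < size tau)
    (let s := tnth (in_tuple tau) j in (-1) ^+ s.2 * x ord0 s.1).

Definition lex_gt (R : realType) (k : nat) (eps : R) (a b : 'rV[R]_k) : Prop :=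
  a <> b /\
  forall i : 'I_k, a ord0 i <> b ord0 i ->
    (forall j : 'I_k, (j < i)%N -> a ord0 j = b ord0 j) ->
    b ord0 i + eps <= a ord0 i.

Definition inter (R : realType) (n : nat) (C : set (set 'rV[R]_n)) :
    set 'rV[R]_n :=
  \bigcap_(A in C) A.

Definition arborescence (V : finType) (E : rel V) (r : V) : Prop :=
  forall v : V, exists! p : seq V, path E r p /\ last r p = v.

Record branching_tree (R : realType) (n : nat) := BranchingTree {
  node : finType;
  edge : rel node;
  tree_root : node;
  bcon : node -> set 'rV[R]_n;
  sigma : node -> seq (sidx n) }.

Section Tree.
Variables (R : realType) (n : nat).
Implicit Types (C D : set (set 'rV[R]_n)) (T : branching_tree R n).

(* As for path, the starting node (here the root) is omitted from the list;   *)
(* in an arborescence the list is uniquely determined.                        *)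
Definition root_path T (v : node T) : seq (node T) :=
  xget [::] [set p | path (@edge R n T) (tree_root T) p /\ last (tree_root T) p = v].

Definition depth T (v : node T) : nat := size (root_path v).

Definition consistent C T : Prop :=
  [/\ arborescence (@edge R n T) (tree_root T),
      bcon (tree_root T) = setT,
      forall u : node T, [set v | edge u v] !=set0 ->
        inter C `<=` \bigcup_(v in [set v | edge u v]) bcon v &
      [/\ forall v : node T,
            (size (sigma v) <= n)%N /\ uniq [seq s.1 | s <- sigma v],
          forall u v : node T, edge u v -> prefix (sigma u) (sigma v),
          forall (v : node T) (i : 'I_(size (sigma v))),
            has_ubound [set sproj (sigma v) x ord0 i | x in inter C] &
          forall u v w : node T, edge u v -> edge u w -> v <> w ->
            sproj (sigma u) @` bcon v `&` sproj (sigma u) @` bcon w = set0]].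

Definition path_cons T (v : node T) : set (set 'rV[R]_n) :=
  [set bcon u | u in [set u | u \in tree_root T :: root_path v]].

(* For x, y in inter C and a C-consistent T the root is a candidate, and the  *)
(* candidates form a path from the root, so the maximizer is unique.          *)
Definition dcn C T (x y : 'rV[R]_n) : node T :=
  [arg max_(w > tree_root T | `[< inter (C `|` path_cons w) x /\
                             inter (C `|` path_cons w) y >]) depth w]%N.

(* Only meant for x, y in inter C; C is an argument because it determines dcn. *)
Definition tree_ge C (eps : R) T (x y : 'rV[R]_n) : Prop :=
  let v := dcn C T x y in
  sproj (sigma v) x = sproj (sigma v) y \/
  lex_gt eps (sproj (sigma v) x) (sproj (sigma v) y).

End Tree.

Record configuration (R : realType) (n : nat) := Configuration {
  cfgC : set (set 'rV[R]_n);
  cfgD : set (set 'rV[R]_n);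
  cfg_obj : 'rV[R]_n -> R;
  cfg_bound : {z : \bar R | z != -oo%E};
  cfg_tree : branching_tree R n;
  cfg_eps : R }.

Definition valid (R : realType) (n : nat) (F : set 'rV[R]_n)
    (f : 'rV[R]_n -> R) (c : configuration R n) : Prop :=
  let: Configuration C D g z T eps := c in
  [/\ consistent C T /\ 0 < eps,
      (val z < +oo)%E -> exists x, F x /\ ((f x)%:E <= val z)%E,
      forall zhat : R, (zhat%:E < val z)%E ->
        (exists x, F x /\ f x <= zhat) <-> (exists x, inter C x /\ g x <= zhat) &
      forall x, inter C x -> ((g x)%:E < val z)%E ->
        exists y, [/\ inter (C `|` D) y, tree_ge C eps T y x & g y <= g x]].

(* Main.v *)
Require Import Defs.
From mathcomp Require Import all_boot all_order all_algebra.
From mathcomp Require Import all_classical all_reals.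

Local Open Scope classical_set_scope.
Local Open Scope ring_scope.

(** Moving a constraint [A] from [D] to [C] leaves [C `|` D] unchanged, so the
    dominating point [y] that validity provides for a point [x] of [inter C]
    below the bound already satisfies [A].  Hence every objective value attained
    there is matched or improved in [inter (C `|` [set A])], and the equivalence
    with the original problem [F] is preserved.  Tree consistency survives
    because it can only become weaker when [inter C] shrinks
    ([consistent_subset]).

    Domination itself needs care, since [tree_ge] depends on [C] through the
    deepest common node.  But for the enlarged [C] the dominated point [x]
    satisfies [A], and so does [y]; the nodes common to [x] and [y] are then the
    same for [C] and for [C `|` [set A]] ([dcn_setU]), and the relation between
    them is unchanged. *)

Lemma inter_setU (R : realType) (n : nat) (C D : set (set 'rV[R]_n)) :
  inter (C `|` D) = inter C `&` inter D.
Proof. exact: bigcap_setU. Qed.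

Lemma inter_subset (R : realType) (n : nat) (C D : set (set 'rV[R]_n)) :
  C `<=` D -> inter D `<=` inter C.
Proof. by move=> CD x Dx A /CD; exact: Dx. Qed.

(** The constraints enter consistency only through the covering by the children
    and the upper bounds on the entries of [sigma], both inherited by subsets of
    [inter C]. *)
Lemma consistent_subset (R : realType) (n : nat) (C D : set (set 'rV[R]_n))
    (T : branching_tree R n) :
  C `<=` D -> consistent C T -> consistent D T.
Proof.
move=> /inter_subset DC [arb root cover [uniqs prefixes bounded disj]].
split=> // [u hasv|]; first by move=> x /DC; exact: cover.
split=> // v i; apply: subset_has_ubound (bounded v i).
by apply: image_subset.
Qed.

(** The deepest common node is a maximizer over the nodes [w] whose path
    constraints, together with [C], hold at [x] and [y]; constraints that hold at
    both points do not change this set of candidates. *)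
Lemma dcn_setU (R : realType) (n : nat) (C D : set (set 'rV[R]_n))
    (T : branching_tree R n) (x y : 'rV[R]_n) :
  inter D x -> inter D y -> dcn (C `|` D) T x y = dcn C T x y.
Proof.
move=> Dx Dy; rewrite /dcn; congr (arg_max _ _ _).
apply/funext => w; apply: asbool_equiv_eq.
rewrite setUAC (inter_setU _ _ _ D).
by split=> [[[? _] [? _]]|[]].
Qed.

Theorem theorem9 (R : realType) (n : nat) (F : set 'rV[R]_n)
    (f : 'rV[R]_n -> R) (C D : set (set 'rV[R]_n)) (g : 'rV[R]_n -> R)
    (z : {z : \bar R | z != -oo%E}) (T : branching_tree R n) (eps : R)
    (A : set 'rV[R]_n) :
  valid F f (Configuration C D g z T eps) ->
  D A ->
  valid F f (Configuration (C `|` [set A]) (D `\ A) g z T eps).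
Proof.
move=> [[consT eps_gt0] primal equiv dominated] DA.
have CDE : (C `|` [set A]) `|` (D `\ A) = C `|` D.
  by rewrite -setUA setDUK// => _ ->.
have subA : inter (C `|` D) `<=` inter (C `|` [set A]).
  by apply: inter_subset; apply: setUS => _ ->.
have subC : inter (C `|` [set A]) `<=` inter C.
  by apply: inter_subset; exact: subsetUl.
split=> //.
- by split=> //; apply: consistent_subset consT; exact: subsetUl.
- move=> zhat zhat_lt; rewrite (equiv _ zhat_lt); split=> -[x [Cx gx]].
  + have gx_lt : ((g x)%:E < val z)%E.
      by apply: Order.POrderTheory.le_lt_trans zhat_lt; rewrite lee_fin.
    have [y [CDy _ gyx]] := dominated x Cx gx_lt.
    exists y; split; first exact: subA.
    exact: Order.POrderTheory.le_trans gyx gx.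
  + by exists x; split=> //; exact: subC.
- move=> x CAx gx_lt; have [y [CDy yx gyx]] := dominated x (subC _ CAx) gx_lt.
  exists y; rewrite CDE; split=> //.
  have := subA _ CDy; rewrite inter_setU => -[_ Ay].
  move: CAx; rewrite inter_setU => -[_ Ax].
  by rewrite /tree_ge dcn_setU.
Qed.
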